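(* Let $T$ be a tree of order $p$ and diameter $d(T)$, let $G=\mathcal{L}(T)$ be its line graph, and assume $|W(G)|\ge 2$ (so $\varepsilon(G)=0$) and $G$ is a lower bound block graph. Assume there exists an ordering $\vec u=(u_0,u_1,\ldots,u_{p-2})$ of $V(G)$ satisfying (a) $L(u_0)+L(u_{p-2})=\varepsilon(G)$; (b) for $0\le i\le p-3$, $u_i$ and $u_{i+1}$ are in opposite branches of $G$ (i.e. $\rho(u_i,u_{i+1})=\phi(u_i,u_{i+1})=0$ and $\delta(u_i,u_{i+1})=1-\varepsilon(G)$); (c) the mapping $f$ on $V(G)$ defined by $f(u_0)=0$ and $f(u_{i+1})=f(u_i)+d(G)+\varepsilon(G)-L(u_{i+1})-L(u_i)$ for $0\le i\le p-3$ is a radio labeling of $G$; and such that the following holds for all $0\le i<j\le p-2$: if one of $u_i,u_j$ is a descendant of the other in $\mathcal{L}(T)$, then $|j-i|\ge d(\mathcal{L}(T))+1$. Then $T$ is a lower bound tree, and $rn(T)=rn(\mathcal{L}(T))+d(\mathcal{L}(T))+1$.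
   Context: Graphs are finite and simple. For a connected graph $G$, $d(u,v)$ is the distance and $d(G)$ the diameter. A radio labeling of $G$ is a map $f:V(G)\to\{0,1,2,\ldots\}$ with $|f(u)-f(v)|\ge d(G)+1-d(u,v)$ for all distinct $u,v$. Its span is $\max\{|f(u)-f(v)|:u,v\in V(G)\}$, and $rn(G)$ is the minimum span of a radio labeling of $G$. A block is a maximal connected induced subgraph without cut-vertices (of itself). A block graph is a connected graph all of whose blocks are complete graphs; between any two vertices $u,v$ of it there is a unique shortest path ($(u,v)$-geodesic) $P_{uv}$. Trees and line graphs of trees are block graphs. The weight at $v$ is $wt(v)=\sum_{u\in V(G)}d(u,v)$, and $W(G)$ is the set of vertices of minimum weight (weight centers). If $|W(G)|\ge2$, then $W(G)$ is contained in a (unique) block, called the central block. The central vertices of $G$ are: the unique weight center if $|W(G)|=1$; all vertices of the central block if $|W(G)|\ge 2$. The level of $v$ is $L(v)=\min\{d(v,w): w \text{ a central vertex}\}$ and $L(G)=\sum_{v\in V(G)}L(v)$. Set $\varepsilon(G)=1$ if $|W(G)|=1$ and $\varepsilon(G)=0$ if $|W(G)|\ge2$. For a block graph $G$ of order $q$ put $LB(G)=(q-1)(d(G)+\varepsilon(G))-2L(G)+\varepsilon(G)$; $G$ is called a lower bound block graph (a lower bound tree, if $G$ is a tree) if $rn(G)=LB(G)$. If $u$ lies on the $(w,v)$-geodesic, where $w$ is the central vertex nearest to $v$, then $u$ is an ancestor of $v$ and $v$ a descendant of $u$. A non-central block $D$ containing a central vertex $w$ is said to be adjacent to $w$; the subgraph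 induced by $V(D)\setminus\{w\}$ together with the descendants of these vertices is a branch. Two branches are opposite if they come from blocks adjacent to different central vertices; two vertices are in opposite branches if they belong to opposite branches. $\phi(u,v)=\max\{L(x): x\text{ is a common ancestor of }u\text{ and }v\}$ (equal to $0$ if there is no common ancestor). $\delta(u,v)=1$ if $P_{uv}$ contains two central vertices, and $0$ otherwise. $\rho(u,v)=0$ if $P_{uv}$ contains a central vertex or a common ancestor of $u$ and $v$, and $1$ otherwise. In condition (b), the precise meaning (also when one of the vertices is a central vertex) is the one given by the ''i.e.'' clause. The line graph $\mathcal{L}(T)$ has the edges of $T$ as vertices, two being adjacent if they share an endpoint. *)

(* Defs.v *)
From HB Require Import structures.
From mathcomp Require Import all_boot all_order all_algebra.
From mathcomp Require Import boolp.

Set Implicit Arguments.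
Unset Strict Implicit.
Unset Printing Implicit Defensive.

(* Finite simple graphs *)

Record sgraph := SGraph {
  svertex :> finType;
  sedge : rel svertex;
  sedge_sym : symmetric sedge;
  sedge_irrefl : irreflexive sedge }.

Definition edge_set (G : sgraph) : {set {set G}} :=
  [set E : {set G} | [exists u : G, exists v : G,
     sedge u v && (E == [set u; v])]].

Section LineGraph.

Variable G : sgraph.

Definition line_vertex : finType := {E : {set G} | E \in edge_set G}.

Definition line_rel : rel line_vertex :=
  [rel E F | (E != F) && (val E :&: val F != set0)].

Lemma line_rel_sym : symmetric line_rel.
Proof. by move=> E F; rewrite /line_rel /= eq_sym setIC. Qed.

Lemma line_rel_irrefl : irreflexive line_rel.
Proof. by move=> E; rewrite /line_rel /= eqxx. Qed.

Definition line_graph : sgraph := SGraph line_rel_sym line_rel_irrefl.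

End LineGraph.

Section Graph.

Variable G : sgraph.
Implicit Types (u v w x : G) (S B : {set G}).

(* Any two vertices of S are joined by a path of the subgraph induced by S;
   this includes the empty set. *)
Definition connected_in S : bool :=
  [forall u in S, forall v in S,
     connect [rel a b : G | [&& sedge a b, a \in S & b \in S]] u v].

Definition connected : bool := (0 < #|G|) && connected_in [set: G].

Definition is_tree : Prop :=
  connected /\ forall c : seq G, cycle (@sedge G) c -> uniq c -> size c < 3.

(* Cut-vertices of a connected induced subgraph. *)
Definition cut_vertex S v : bool := (v \in S) && ~~ connected_in (S :\ v).

Definition block B : bool :=
  maxset (fun S => connected_in S && [forall v, ~~ cut_vertex S v]) B.

Definition is_block_graph : Prop :=
  connected /\
  forall B, block B -> {in B &, forall u v, u != v -> sedge u v}.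

(* As [iota 0 n] lists 0, ..., n.-1, the index returned by [find] is the least
   length of a walk from u to v (and #|G| if there is none). *)
Definition dist u v : nat :=
  find (fun n => [exists p : n.-tuple G,
                    path (@sedge G) u p && (last u p == v)])
       (iota 0 #|G|).

Definition diam : nat := \max_(u : G) \max_(v : G) dist u v.

(* The vertices of the shortest paths from u to v; in a block graph there is
   only one such path. *)
Definition geodesic u v : {set G} :=
  [set x | [exists p : (dist u v).-tuple G,
              [&& path (@sedge G) u p, last u p == v & x \in u :: p]]].

Definition radio_labeling (f : G -> nat) : Prop :=
  forall u v, u != v -> diam + 1 - dist u v <= `|f u - f v|%N.

Definition span (f : G -> nat) : nat :=
  \max_(u : G) \max_(v : G) `|f u - f v|%N.

Lemma radio_span_exists :
  exists n, `[< exists f, radio_labeling f /\ span f = n >].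
Proof.
pose f (v : G) := enum_rank v * diam.+1.
exists (span f); apply/asboolP; exists f; split=> // u v neq_uv.
apply: leq_trans (leq_subr _ _) _; rewrite addn1 /f.
have rank_neq : enum_rank u != enum_rank v :> nat.
  by apply: contra neq_uv => /eqP/val_inj/enum_rank_inj->.
have mulB (a b : nat) : `|a * diam.+1 - b * diam.+1|%N = `|a - b|%N * diam.+1.
  by rewrite !PoszM -GRing.mulrBl abszM.
by rewrite mulB leq_pmull // lt0n distn_eq0.
Qed.

Definition radio_number : nat := ex_minn radio_span_exists.

Definition weight v : nat := \sum_(u : G) dist u v.

Definition weight_centers : {set G} := [set v | [forall u, weight v <= weight u]].

(* In the second case exactly one block contains the weight centers if G is a
   block graph, so that the union is the central block. *)
Definition central : {set G} :=
  if #|weight_centers| == 1 then weight_centers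
  else \bigcup_(B : {set G} | block B && (weight_centers \subset B)) B.

(* [dist] is bounded by #|G|, which is thus neutral for this minimum. *)
Definition level v : nat := \big[minn/#|G|]_(w in central) dist v w.

Definition total_level : nat := \sum_(v : G) level v.

Definition eps : nat := (#|weight_centers| == 1).

Definition LB : int :=
  ((#|G|%:Z - 1) * (diam + eps)%:Z - 2 * total_level%:Z + eps%:Z)%R.

Definition lower_bound_block_graph : Prop :=
  is_block_graph /\ radio_number%:Z%R = LB.

Definition lower_bound_tree : Prop :=
  is_tree /\ radio_number%:Z%R = LB.

Definition ancestor u v : bool :=
  [exists w in central, (dist v w == level v) && (u \in geodesic w v)].

Definition common_ancestor x u v : bool := ancestor x u && ancestor x v.

Definition phi u v : nat := \max_(x | common_ancestor x u v) level x.

(* A geodesic of a block graph has at most two central vertices. *)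
Definition delta u v : nat := 2 <= #|geodesic u v :&: central|.

Definition rho u v : nat :=
  ~~ [exists x in geodesic u v, (x \in central) || common_ancestor x u v].

(* u 0, ..., u n.-1 lists every vertex exactly once; the other values of u are
   irrelevant. *)
Definition is_ordering (n : nat) (u : nat -> G) : Prop :=
  (forall i j, i < n -> j < n -> u i = u j -> i = j) /\
  (forall v, exists2 i, i < n & u i = v).

End Graph.

Arguments connected : clear implicits.
Arguments is_tree : clear implicits.
Arguments is_block_graph : clear implicits.
Arguments diam : clear implicits.
Arguments radio_number : clear implicits.
Arguments weight_centers : clear implicits.
Arguments central : clear implicits.
Arguments total_level : clear implicits.
Arguments eps : clear implicits.
Arguments LB : clear implicits.
Arguments lower_bound_block_graph : clear implicits.
Arguments lower_bound_tree : clear implicits.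

(* Main.v *)
From mathcomp Require Import all_boot all_order all_algebra.
From mathcomp Require Import boolp zify.
Require Import Defs.

Set Implicit Arguments.
Unset Strict Implicit.
Unset Printing Implicit Defensive.

(** Write G for the line graph of the tree T. The weight of an edge ab,
computed in G, is (wt a + wt b - p) / 2 (lemma [weight_line]), and wt is
strictly convex along the paths of T (lemma [weight_convex]). Hence every
weight center of G, being an edge with minimal wt a + wt b, is incident to
each weight center of T; as G has two weight centers, T has exactly one, w
(lemma [weight_center_uniq]), and the central vertices of G are the edges at w
(lemma [central_line]).

A vertex v other than w is represented in G by the edge e_v joining it to its
parent, the neighbor of v on the way to w. This is a bijection onto G that
lowers levels by one (lemma [level_line]), and the diameter of T exceeds that
of G by one (lemma [diam_line]). So LB(T) = LB(G) + d(G) + 1, and it remains to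
show rn(T) = LB(T).

The lower bound holds in every graph with a single vertex of level 0 in which
the distance of two vertices is at most the sum of their levels: list the
vertices by increasing label, add up the radio conditions of consecutive
vertices, and use that at most one end of the list has level 0 (lemma
[radio_number_ge]).

For the upper bound, let g be the given labeling of G, label w by 0 and v by
g(e_v) + d(G) + 1. If neither of e_v, e_v' descends from the other, then
d(v, v') = d(e_v, e_v') + 1 (lemma [dist_line_or_ancestor]), and the radio
condition for g is the one needed in T. Otherwise e_v and e_v' are at least
d(G) + 1 places apart in the ordering, and since g strictly increases along the
ordering their labels differ by at least d(G) + 1 = d(T), which is enough for
any two vertices. The largest label is g(u_{p-2}) + d(G) + 1, and g(u_{p-2}) is
LB(G) by telescoping the recursion for g (lemma [labeling_last]). *)

(** * Distance and level in connected graphs *)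

Section Distance.

Variable G : sgraph.
Implicit Types (u v x y : G) (p : seq G).

Lemma dist_le_card u v : dist u v <= #|G|.
Proof. by apply: leq_trans (find_size _ _) _; rewrite size_iota. Qed.

Lemma dist_le_size u p : path (@sedge G) u p -> dist u (last u p) <= size p.
Proof.
move=> path_p; case: (leqP #|G| (size p)) => [le_p|lt_p].
  exact: leq_trans (dist_le_card _ _) le_p.
rewrite leqNgt; apply/negP => /(before_find 0)/negbT.
by rewrite nth_iota // add0n => /existsPn/(_ (in_tuple p)); rewrite path_p eqxx.
Qed.

Lemma distxx u : dist u u = 0.
Proof. by have := @dist_le_size u [::] isT; rewrite leqn0 => /eqP. Qed.

Lemma dist_diam u v : dist u v <= diam G.
Proof.
by rewrite /diam (bigD1 u) //= (bigD1 v) //= -maxnA leq_maxl.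
Qed.

Lemma diam_le k : (forall u v, dist u v <= k) -> diam G <= k.
Proof. by move=> le_k; apply/bigmax_leqP => u _; apply/bigmax_leqP. Qed.

Hypothesis cG : connected G.

Lemma dist_path u v :
  exists p, [/\ path (@sedge G) u p, last u p = v & size p = dist u v].
Proof.
have [_ /forall_inP/(_ u (in_setT u))/forall_inP/(_ v (in_setT v))] := andP cG.
case/connectP => p0 path_p0 ->; case/shortenP: path_p0 => p path_p uniq_p _.
have lt_p : size p < #|G| by have := max_card (mem (u :: p)); rewrite (card_uniqP uniq_p).
have {}path_p : path (@sedge G) u p by apply: sub_path path_p => a b /and3P[].
pose a n := [exists q : n.-tuple G,
               path (@sedge G) u q && (last u q == last u p)].
have has_a : has a (iota 0 #|G|).
  apply/hasP; exists (size p); first by rewrite mem_iota.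
  by apply/existsP; exists (in_tuple p); rewrite path_p eqxx.
have := nth_find 0 has_a; rewrite nth_iota ?add0n; last first.
  by rewrite -[X in _ < X](size_iota 0) -has_find.
case/existsP => q /andP[path_q /eqP last_q]; exists q.
by rewrite path_q last_q size_tuple.
Qed.

Lemma dist_sym u v : dist u v = dist v u.
Proof.
wlog suff le_d : u v / dist u v <= dist v u.
  by apply/eqP; rewrite eqn_leq !le_d.
have [p [path_p <- <-]] := dist_path v u.
have := @dist_le_size (last v p) (rev (belast v p)).
rewrite size_rev size_belast rev_path.
have -> : last (last v p) (rev (belast v p)) = v.
  by case: p {path_p} => //= y p; rewrite rev_cons last_rcons.
by apply; apply: sub_path path_p => a b; rewrite sedge_sym.
Qed.

Lemma dist_triangle v u x : dist u x <= dist u v + dist v x.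
Proof.
have [p [path_p last_p <-]] := dist_path u v.
have [q [path_q last_q <-]] := dist_path v x.
have := @dist_le_size u (p ++ q).
rewrite last_cat last_p last_q size_cat; apply.
by rewrite cat_path path_p last_p.
Qed.

Lemma dist_eq0 u v : (dist u v == 0) = (u == v).
Proof.
apply/eqP/eqP => [d0|->]; last exact: distxx.
by have [p] := dist_path u v; rewrite d0; case: p => [[_ <-]|y p []].
Qed.

Lemma dist_edge u v : sedge u v -> dist u v = 1.
Proof.
move=> e_uv; apply/eqP; rewrite eqn_leq lt0n dist_eq0.
have /= -> := @dist_le_size u [:: v]; last by rewrite /= e_uv.
by apply: contraTneq e_uv => ->; rewrite sedge_irrefl.
Qed.

Lemma closer_neighbor x v :
  v != x -> exists2 y, sedge v y & dist x v = (dist x y).+1.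
Proof.
rewrite dist_sym => neq_vx; have [p] := dist_path v x.
case: p => [[_ /eqP]|y p [/= /andP[e_vy path_p] last_p size_p]].
  by rewrite /= (negPf neq_vx).
exists y => //; apply/eqP; rewrite eqn_leq -{2}size_p.
have := dist_triangle y v x; rewrite (dist_edge e_vy) (dist_sym x y) => -> /=.
by rewrite ltnS -last_p dist_le_size.
Qed.

Lemma mem_geodesic u v x :
  (x \in geodesic u v) = (dist u x + dist x v == dist u v).
Proof.
rewrite inE; apply/existsP/eqP => [[p /and3P[path_p /eqP last_p x_p]]|d_x].
  apply/eqP; rewrite eqn_leq dist_triangle andbT -[leqRHS](size_tuple p).
  case/splitPl: x_p path_p last_p => p1 p2 last_p1.
  rewrite cat_path last_cat last_p1 size_cat => /andP[path_p1 path_p2] <-.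
  by rewrite leq_add ?dist_le_size // -{1}last_p1 dist_le_size.
have [p [path_p last_p size_p]] := dist_path u x.
have [q [path_q last_q size_q]] := dist_path x v.
have size_pq : size (p ++ q) == dist u v by rewrite size_cat size_p size_q d_x.
exists (Tuple size_pq); rewrite /= cat_path last_cat path_p last_p path_q last_q.
by rewrite eqxx -cat_cons mem_cat -last_p mem_last.
Qed.

End Distance.

Section Level.

Variable G : sgraph.
Implicit Types (v c : G).

Lemma level_le v c : c \in central G -> level v <= dist v c.
Proof.
move=> c_central; rewrite /level.
elim: (index_enum G) (mem_index_enum c) => // b s IHs.
rewrite inE big_cons => /predU1P[<-|/IHs le_s].
  by rewrite c_central geq_minl.
by case: ifP => // _; rewrite geq_min le_s orbT.
Qed.

Lemma level_eq v c :
    c \in central G -> {in central G, forall c', dist v c <= dist v c'} ->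
  level v = dist v c.
Proof.
move=> c_central c_min; apply/eqP; rewrite eqn_leq level_le //=.
apply: (big_ind (fun m => dist v c <= m)) => [|m n le_m le_n|//].
  exact: dist_le_card.
by rewrite leq_min le_m.
Qed.

End Level.

(* [dist] is an exhaustive search; from here on only its metric properties matter. *)
Opaque dist diam.

(** * Trees *)

Section Tree.

Variable T : sgraph.
Hypothesis treeT : is_tree T.
Implicit Types (a b c d v w x y : T).

Lemma tree_connected : connected T.
Proof. by case: treeT. Qed.

Let cT := tree_connected.

(** Two such neighbors would both be linked to x by shortest paths, which avoid
v because their vertices are no farther from x than v is; joining these paths
and closing up through v gives a cycle of length at least 3. *)
Lemma lower_neighbor_uniq x v a b :
    sedge v a -> sedge v b -> dist x a <= dist x v -> dist x b <= dist x v ->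
  a = b.
Proof.
move=> e_va e_vb le_a le_b; apply/eqP/negPn/negP => neq_ab.
pose r := [rel y z : T | [&& sedge y z, y != v & z != v]].
have sym_r : connect_sym r.
  by apply: sym_connect_sym => y z /=; rewrite sedge_sym [_ && (z != v)]andbC.
have to_x y : dist x y <= dist x v -> y != v -> connect r y x.
  have [n] := ubnP (dist x y); elim: n y => // n IHn y lt_n le_y neq_yv.
  have [->|neq_yx] := eqVneq y x; first exact: connect0.
  have [z e_yz d_y] := closer_neighbor cT neq_yx.
  have neq_zv : z != v by apply: contraTneq le_y => <-; rewrite d_y ltnn.
  apply: connect_trans (connect1 _) (IHn z _ _ neq_zv); last by lia.
    by rewrite /= e_yz neq_yv.
  by lia.
have neq_v y : sedge v y -> y != v.
  by apply: contraTneq => ->; rewrite sedge_irrefl.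
have : connect r a b.
  apply: connect_trans (to_x a le_a (neq_v a e_va)) _.
  by rewrite sym_r to_x ?neq_v.
case/connectP => p0 path_p0 b_p0; case/shortenP: path_p0 b_p0 => p path_p uniq_p _ b_p.
have v_p : v \notin a :: p.
  apply/negP; rewrite inE eq_sym (negPf (neq_v a e_va)) /= => v_p.
  have [q1 [q2 def_p]] : exists q1 q2, p = q1 ++ v :: q2.
    by case/splitPr: v_p => q1 q2; exists q1, q2.
  by move: path_p; rewrite def_p cat_path /= eqxx !andbF.
have [_ /(_ [:: v, a & p])] := treeT.
have path_sp : path (@sedge T) a p by apply: sub_path path_p => y z /and3P[].
case/(_ _ _)/idPn; last first.
- by case: (p) b_p neq_ab => //= ->; rewrite eqxx.
- by rewrite cons_uniq v_p.
by rewrite /= e_va rcons_path path_sp -b_p sedge_sym.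
Qed.

Lemma farther_neighbor x v a b :
    sedge v a -> sedge v b -> a != b -> dist x a <= dist x v ->
  dist x b = (dist x v).+1.
Proof.
move=> e_va e_vb neq_ab le_a; have := dist_triangle cT v x b.
rewrite (dist_edge cT e_vb); case: (leqP (dist x b) (dist x v)) => [le_b|]; last lia.
by rewrite (lower_neighbor_uniq e_va e_vb le_a le_b) eqxx in neq_ab.
Qed.

(** Trees are bipartite. *)
Lemma dist_edge_parity x a b :
  sedge a b -> dist x a = (dist x b).+1 \/ dist x b = (dist x a).+1.
Proof.
move=> e_ab; have [eq_ax|neq_ax] := eqVneq a x.
  by right; rewrite -eq_ax distxx (dist_edge cT).
have [c e_ac d_a] := closer_neighbor cT neq_ax.
have [<-|neq_cb] := eqVneq c b; [by left | right].
by apply: farther_neighbor e_ac e_ab neq_cb _; rewrite d_a.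
Qed.

(** Removing an edge cd splits a tree into the vertices closer to c and those
closer to d, and cd is the only edge from one part to the other. *)
Lemma edge_cut a b c d :
    sedge a b -> sedge c d ->
    dist a c < dist a d -> dist b d < dist b c -> a = c /\ b = d.
Proof.
have cut a' b' c' d' : sedge a' b' -> sedge c' d' ->
    dist a' c' < dist a' d' -> dist b' d' < dist b' c' -> a' = c'.
  move=> s_ab s_cd lt_a lt_b; apply/eqP/negPn/negP => neq_ac.
  have [y s_ay] := closer_neighbor cT neq_ac.
  rewrite !(dist_sym cT c') => d_a.
  have par_a := dist_edge_parity a' s_cd; have par_b := dist_edge_parity b' s_cd.
  have := dist_edge_parity c' s_ab; rewrite !(dist_sym cT c') => par_c.
  have := dist_edge_parity d' s_ab; rewrite !(dist_sym cT d') => par_d.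
  have := dist_triangle cT c' y d'; rewrite (dist_edge cT s_cd) => le_y.
  (* y and b' are both closer to d' than a' is, but they differ, since y is
     closer to c' than a' and b' is not. *)
  suff eq_y : y = b' by rewrite eq_y in d_a; lia.
  apply: (lower_neighbor_uniq (x := d') s_ay s_ab); rewrite !(dist_sym cT d').
    by rewrite -ltnS; lia.
  by lia.
move=> s_ab s_cd lt_a lt_b; split; first exact: cut s_ab s_cd lt_a lt_b.
by apply: (cut b a d c); rewrite // sedge_sym.
Qed.

(** The neighbor of v on the way to the root x; at the root itself, where no
neighbor is closer, the value is arbitrary. *)
Definition parent x v : T :=
  odflt v [pick y | sedge v y && (dist x v == (dist x y).+1)].

Lemma parentP x v :
  v != x -> sedge v (parent x v) /\ dist x v = (dist x (parent x v)).+1.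
Proof.
move=> neq_vx; rewrite /parent; case: pickP => [y /andP[-> /eqP]|no] //.
have [y e_vy d_v] := closer_neighbor cT neq_vx.
by have := no y; rewrite e_vy d_v eqxx.
Qed.

(** If leaving v towards x moves away from y, then v lies between x and y:
the path from v to y starts with a child of v, and keeps going down. *)
Lemma dist_below x v y :
  dist (parent x v) y = (dist v y).+1 -> v != x ->
  dist x y = dist x v + dist v y.
Proof.
have [n] := ubnP (dist v y); elim: n v => // n IHn v lt_n d_y neq_vx.
have [->|neq_yv] := eqVneq y v; first by rewrite distxx addn0.
have [e_vp d_v] := parentP neq_vx.
have neq_vy : v != y by rewrite eq_sym.
have [z e_vz d_vz] := closer_neighbor cT neq_vy.
rewrite !(dist_sym cT y) in d_vz.
have neq_pz : parent x v != z by apply/eqP => eq_pz; rewrite eq_pz d_vz in d_y; lia.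
have d_z : dist x z = (dist x v).+1.
  by apply: farther_neighbor e_vp e_vz neq_pz _; rewrite d_v.
have neq_zx : z != x by rewrite -(dist_eq0 cT) (dist_sym cT) d_z.
have [e_zp d_zp] := parentP neq_zx.
have par_z : parent x z = v.
  apply: (@lower_neighbor_uniq x z); rewrite ?d_z ?d_zp //; [by rewrite sedge_sym|lia].
by rewrite (IHn z) ?par_z ?d_z ?d_vz ?addSnnS // -ltnS -d_vz.
Qed.

(** Seen from any vertex x, at most one of a and c is closer than b, so that
d(a, x) + d(c, x) >= 2 d(b, x); the inequality is strict for x = b. *)
Lemma weight_convex a b c :
  sedge b a -> sedge b c -> a != c -> 2 * weight b < weight a + weight c.
Proof.
move=> e_ba e_bc neq_ac; rewrite /weight big_distrr -big_split /=.
rewrite (bigD1 b) //= [X in _ < X](bigD1 b) //= distxx.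
rewrite (dist_edge cT e_ba) (dist_edge cT e_bc) muln0 add0n.
suff /leq_trans: \sum_(x | x != b) 2 * dist x b
                  <= \sum_(x | x != b) (dist x a + dist x c) by apply; lia.
apply: leq_sum => x _.
have := @farther_neighbor x b c a e_bc e_ba; rewrite eq_sym => /(_ neq_ac).
have := @farther_neighbor x b a c e_ba e_bc neq_ac.
have := dist_edge_parity x e_ba; have := dist_edge_parity x e_bc.
by lia.
Qed.

End Tree.

(** * Line graphs *)

Lemma set2_eq (T : finType) (a b c d : T) :
  [set a; b] = [set c; d] -> a = c /\ b = d \/ a = d /\ b = c.
Proof.
move=> eq_set.
have /setP/(_ a) := eq_set; have /setP/(_ b) := eq_set.
have /setP/(_ c) := eq_set; have /setP/(_ d) := eq_set.
rewrite !inE !eqxx ?orbT /= => /orP[]/eqP-> /orP[]/eqP-> //; auto.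
- by move=> /esym; rewrite orbb => /eqP ->; auto.
- by move=> _ /esym; rewrite orbb => /eqP ->; auto.
Qed.

Lemma clique_connected_in (G : sgraph) (S : {set G}) :
  {in S &, forall u v, u != v -> sedge u v} -> connected_in S.
Proof.
move=> clique; apply/forall_inP => u u_S; apply/forall_inP => v v_S.
have [->|neq_uv] := eqVneq u v; first exact: connect0.
by apply: connect1; rewrite /= u_S v_S clique.
Qed.

Section LineGraph.

Variable T : sgraph.
Implicit Types (a b c d x y : T) (e f g : line_graph T).

Lemma line_vertexP e : exists a b, sedge a b /\ val e = [set a; b].
Proof.
have := valP e; rewrite inE => /existsP[a /existsP[b /andP[e_ab /eqP eq_e]]].
by exists a, b.
Qed.

Lemma line_vertex_sedge e a b : val e = [set a; b] -> sedge a b.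
Proof.
have [c [d [e_cd ->]]] := line_vertexP e.
by case/set2_eq=> [[<- <-]|[<- <-]] //; rewrite sedge_sym.
Qed.

Lemma line_vertex_mem e x : x \in val e -> exists2 y, sedge x y & val e = [set x; y].
Proof.
have [a [b [e_ab ->]]] := line_vertexP e; rewrite !inE => /orP[]/eqP->.
  by exists b.
by exists a; [rewrite sedge_sym | rewrite setUC].
Qed.

Lemma mem_edge_set a b : sedge a b -> [set a; b] \in edge_set T.
Proof.
move=> e_ab; rewrite inE; apply/existsP; exists a; apply/existsP; exists b.
by rewrite e_ab /=.
Qed.

Lemma edge_line_vertex a b : sedge a b -> exists e, val e = [set a; b].
Proof. by move/mem_edge_set => ab_edge; exists (Sub [set a; b] ab_edge). Qed.

Lemma line_sedgeP e f :
  sedge e f -> e != f /\ exists2 x, x \in val e & x \in val f.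
Proof.
by case/andP=> neq_ef /set0Pn[x]; rewrite inE => /andP[x_e x_f]; split; last exists x.
Qed.

Lemma line_sedge e f x : e != f -> x \in val e -> x \in val f -> sedge e f.
Proof.
by move=> neq_ef x_e x_f; apply/andP; split=> //; apply/set0Pn; exists x; rewrite inE x_e.
Qed.

Hypothesis cT : connected T.
Hypothesis cG : connected (line_graph T).

Lemma line_dist_share e f x : x \in val e -> x \in val f -> dist e f <= 1.
Proof.
move=> x_e x_f; have [->|neq_ef] := eqVneq e f; first by rewrite distxx.
by rewrite (dist_edge cG) // (line_sedge neq_ef x_e).
Qed.

(** Together with the next lemma: the distance of two distinct edges in the line
graph is one more than the least distance between their endpoints. *)
Lemma line_dist_le e f x y :
  x \in val e -> y \in val f -> dist e f <= (dist x y).+1.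
Proof.
have [n] := ubnP (dist x y); elim: n e x => // n IHn e x lt_n x_e y_f.
have [eq_xy|neq_xy] := eqVneq x y.
  by rewrite eq_xy distxx (line_dist_share (x := x)) // eq_xy.
have [z e_xz d_x] := closer_neighbor cT neq_xy.
rewrite !(dist_sym cT y) in d_x.
have [g def_g] := edge_line_vertex e_xz.
have x_g : x \in val g by rewrite def_g set21.
have z_g : z \in val g by rewrite def_g set22.
have le_gf : dist g f <= dist x y by rewrite d_x IHn // -ltnS -d_x.
apply: leq_trans (dist_triangle cG g e f) _.
by rewrite -add1n leq_add // (line_dist_share x_e x_g).
Qed.

Lemma line_dist_ge e f :
  e != f -> exists x y, [/\ x \in val e, y \in val f & dist x y < dist e f].
Proof.
have [n] := ubnP (dist e f); elim: n e => // n IHn e lt_n neq_ef.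
have [g e_eg] := closer_neighbor cG neq_ef; rewrite !(dist_sym cG f) => d_e.
have [neq_eg [z z_e z_g]] := line_sedgeP e_eg.
have [eq_gf|neq_gf] := eqVneq g f.
  by exists z, z; rewrite z_e -eq_gf z_g distxx eq_gf lt0n (dist_eq0 cG).
have [|x [y [x_g y_f lt_xy]]] := IHn g _ neq_gf; first by rewrite -ltnS -d_e.
have le_zx : dist z x <= 1.
  have [z' e_z eq_g] := line_vertex_mem z_g.
  move: x_g; rewrite eq_g !inE => /orP[]/eqP->; first by rewrite distxx.
  by rewrite (dist_edge cT e_z).
exists z, y; rewrite z_e y_f d_e; split=> [//|//|].
rewrite ltnS (leq_trans (dist_triangle cT x z y)) //.
by rewrite -addn1 addnC in lt_xy; rewrite (leq_trans _ lt_xy) ?leq_add2r.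
Qed.

End LineGraph.

(** * Line graphs of trees *)

Section TreeLine.

Variable T : sgraph.
Hypothesis treeT : is_tree T.
Implicit Types (a b c d v w x y : T) (e f g : line_graph T).

Let cT := tree_connected treeT.

(** In a tree rooted at x, each edge is the edge from exactly one non-root vertex
to its parent. *)
Lemma sum_line_vertices x (F : {set T} -> nat) :
  \sum_(e : line_graph T) F (val e) = \sum_(v | v != x) F [set v; parent x v].
Proof.
have -> : \sum_(e : line_graph T) F (val e) = \sum_(E in edge_set T) F E.
  by rewrite (big_sub (edge_set T)).
have -> : edge_set T = [set [set v; parent x v] | v in [set~ x]].
  apply/setP/subset_eqP/andP; split; apply/subsetP => E; last first.
    case/imsetP=> v; rewrite !inE => neq_vx ->.
    by have [/mem_edge_set] := parentP treeT neq_vx; rewrite inE.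
  move=> E_edge; apply/imsetP.
  have [a [b [e_ab ->]]] : exists a b, sedge a b /\ E = [set a; b].
    exact: (line_vertexP (Sub E E_edge : line_graph T)).
  have to_parent a' b' : sedge a' b' -> dist x a' = (dist x b').+1 ->
      a' \in [set~ x] /\ b' = parent x a'.
    move=> s_ab d_a; have neq_ax : a' != x.
      by rewrite eq_sym -(dist_eq0 cT) d_a.
    have [s_ap d_p] := parentP treeT neq_ax.
    rewrite !inE; split=> //.
    by apply: (lower_neighbor_uniq treeT (x := x) s_ab s_ap); lia.
  have [d_a|d_b] := dist_edge_parity treeT x e_ab.
    by have [x_a ->] := to_parent a b e_ab d_a; exists a.
  rewrite sedge_sym in e_ab; have [x_b ->] := to_parent b a e_ab d_b.
  by exists b; rewrite // setUC.
rewrite big_imset /=; first by apply: eq_bigl => v; rewrite !inE.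
move=> v v'; rewrite !inE => neq_v neq_v' /set2_eq[[]//|[eq_v eq_v']].
have [_] := parentP treeT neq_v; have [_] := parentP treeT neq_v'.
by rewrite eq_v' -eq_v; lia.
Qed.

Lemma card_line : #|line_graph T|.+1 = #|T|.
Proof.
have [x _] : exists x : T, true.
  by have /andP[/card_gt0P[x _] _] := cT; exists x.
rewrite -sum1_card (sum_line_vertices x (fun=> 1)) sum1_card.
by rewrite (cardD1 x T) inE /= add1n; congr _.+1; apply: eq_card => y; rewrite !inE andbT.
Qed.

Lemma sum_edge_dist x :
  \sum_(f : line_graph T) \sum_(y in val f) dist x y + #|line_graph T|
  = 2 * weight x.
Proof.
rewrite (sum_line_vertices x (fun E => \sum_(y in E) dist x y)).
rewrite -sum1_card (sum_line_vertices x (fun=> 1)) -big_split /weight /=.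
rewrite [in RHS](bigD1 x) //= distxx add0n big_distrr /=.
apply: eq_bigr => v neq_vx; have [s_v d_v] := parentP treeT neq_vx.
rewrite big_setU1 ?big_set1 /= ?(dist_sym cT v); first by rewrite d_v; lia.
by rewrite inE; apply: contraTneq s_v => <-; rewrite sedge_irrefl.
Qed.

(** Convexity of the weight makes it nondecreasing on the way down from a
minimum. *)
Lemma weight_parent w v :
  w \in weight_centers T -> v != w -> weight (parent w v) <= weight v.
Proof.
rewrite inE => /forallP min_w.
have [n] := ubnP (dist w v); elim: n v => // n IHn v lt_n neq_vw.
have [s_vp d_v] := parentP treeT neq_vw; set q := parent w v in s_vp d_v *.
have [->|neq_qw] := eqVneq q w; first exact: min_w.
have [s_q d_q] := parentP treeT neq_qw.
have := IHn q; rewrite -ltnS -d_v => /(_ lt_n neq_qw).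
have := @weight_convex T treeT (parent w q) q v s_q.
rewrite sedge_sym => /(_ s_vp); case: eqP => [eq_v|_ /(_ isT)]; last lia.
by rewrite eq_v in d_q; lia.
Qed.

Hypothesis cG : connected (line_graph T).

(** The edges ab and cd lie on a path a, b, ..., c, d, their distance in the line
graph being k. *)
Definition aligned k a b c d :=
  [/\ (dist b c).+1 = k, dist a c = k, dist b d = k & dist a d = k.+1].

(** Let b and c be closest endpoints. By parity the distances of the other pairs
are as on a path, except that a and d might be as close as b and c; this would
make ab cross the cut defined by cd. *)
Lemma line_dist_aligned e f a b c d :
    val e = [set a; b] -> val f = [set c; d] -> e != f ->
  let k := dist e f in
  aligned k a b c d \/ aligned k a b d c \/ aligned k b a c d \/ aligned k b a d c.
Proof.
move=> def_e def_f neq_ef k.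
have nearest a' b' c' d' : val e = [set a'; b'] -> val f = [set c'; d'] ->
    dist b' c' < k -> aligned k a' b' c' d'.
  move=> e_ab f_cd lt_k.
  have s_ab := line_vertex_sedge e_ab; have s_cd := line_vertex_sedge f_cd.
  have ge x y : x \in val e -> y \in val f -> k <= (dist x y).+1.
    exact: line_dist_le.
  have := ge a' d'; have := ge a' c'; have := ge b' c'; have := ge b' d'.
  rewrite e_ab f_cd !set21 !set22 => /(_ isT isT) g1 /(_ isT isT) g2.
  move=> /(_ isT isT) g3 /(_ isT isT) g4.
  have p1 := dist_edge_parity treeT b' s_cd.
  have p2 := dist_edge_parity treeT a' s_cd.
  have := dist_edge_parity treeT c' s_ab; rewrite !(dist_sym cT c') => p3.
  have s_ba : sedge b' a' by rewrite sedge_sym.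
  have not_crossed : dist b' c' < dist b' d' -> ~ dist a' d' < dist a' c'.
    move=> lt_b lt_a; have [eq_b eq_a] := edge_cut treeT s_ba s_cd lt_b lt_a.
    by case/eqP: neq_ef; apply: val_inj; rewrite e_ab f_cd eq_b eq_a setUC.
  by split; lia.
have [x [y []]] := line_dist_ge cT cG neq_ef.
have def_e' : val e = [set b; a] by rewrite setUC.
have def_f' : val f = [set d; c] by rewrite setUC.
rewrite {1}def_e {1}def_f !inE => /orP[]/eqP-> /orP[]/eqP-> lt_k.
- by right; right; left; apply: nearest.
- by right; right; right; apply: nearest.
- by left; apply: nearest.
- by right; left; apply: nearest.
Qed.

(** For distinct edges e and f, the four distances between endpoints add up to
4 d(e, f), by [line_dist_aligned]; for e = f they add up to 2. Now sum over f
and use [sum_edge_dist] at both endpoints of e. *)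
Lemma weight_line e a b :
  val e = [set a; b] -> 2 * weight e + #|T| = weight a + weight b.
Proof.
move=> def_e; have s_ab := line_vertex_sedge def_e.
suff : 4 * weight e + 2 = \sum_(f : line_graph T) \sum_(y in val f) dist a y
                        + \sum_(f : line_graph T) \sum_(y in val f) dist b y.
  by have := sum_edge_dist a; have := sum_edge_dist b; have := card_line; lia.
have sum2 : \sum_(f : line_graph T) 2 * (f == e) = 2.
  by rewrite (bigD1 e) //= eqxx muln1 big1 ?addn0 // => f /negPf ->.
rewrite -big_split /= /weight big_distrr /= -[X in _ + X]sum2.
rewrite -big_split /=; apply: eq_bigr => f _.
have [c [d [s_cd def_f]]] := line_vertexP f.
have neq_cd : c \notin [set d].
  by rewrite inE; apply: contraTneq s_cd => ->; rewrite sedge_irrefl.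
rewrite def_f !big_setU1 ?big_set1 //=.
have [eq_fe|neq_fe] := eqVneq f e.
  rewrite eq_fe distxx; move: def_f; rewrite eq_fe def_e.
  by case/set2_eq=> [[<- <-]|[<- <-]];
    rewrite !distxx (dist_sym cT b) (dist_edge cT s_ab); lia.
have neq_ef : e != f by rewrite eq_sym.
rewrite (dist_sym cG).
by case: (line_dist_aligned def_e def_f neq_ef) => [[]|[[]|[[]|[]]]]; lia.
Qed.

(** Suppose that e = ab avoids w, with a the endpoint closer to w, and let q be
the parent of a. Minimality of ab against the edge aq gives wt b <= wt q, and
wt q <= wt a since the weight does not decrease away from w; this contradicts
convexity at a. *)
Lemma center_in_min_edge w e :
  w \in weight_centers T -> e \in weight_centers (line_graph T) -> w \in val e.
Proof.
move=> w_center; rewrite inE => /forallP min_e.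
have near a b : val e = [set a; b] -> dist w b = (dist w a).+1 -> w = a.
  move=> def_e d_b; apply/esym/eqP/negPn/negP => neq_aw.
  have [s_p d_a] := parentP treeT neq_aw.
  have [f def_f] := edge_line_vertex s_p.
  have := min_e f; have := weight_line def_e; have := weight_line def_f.
  have := weight_parent w_center neq_aw.
  have := weight_convex treeT s_p (line_vertex_sedge def_e).
  case: eqP => [eq_p|_ /(_ isT)]; last lia.
  by rewrite eq_p in d_a; lia.
have [a [b [s_ab def_e]]] := line_vertexP e.
have [d_a|d_b] := dist_edge_parity treeT w s_ab.
  by rewrite def_e (near b a) ?set22 // setUC.
by rewrite def_e (near a b) ?set21.
Qed.

(** Two weight centers of the tree would both lie on each of two distinct
edges. *)
Lemma weight_center_uniq :
  2 <= #|weight_centers (line_graph T)| -> exists w, weight_centers T = [set w].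
Proof.
case/card_gt1P=> e [f [e_center f_center neq_ef]].
have [x0 _] : exists x : T, true.
  by have /andP[/card_gt0P[x _] _] := cT; exists x.
have [w _ min_w] := arg_minnP (P := xpredT) (@weight T) (erefl (xpredT x0)).
have w_center : w \in weight_centers T by rewrite inE; apply/forallP => v; apply: min_w.
exists w; apply/setP/subset_eqP/andP; rewrite sub1set; split=> //.
apply/subsetP => w' w'_center; rewrite inE; apply/negPn/negP => neq_w.
have pair g : g \in weight_centers (line_graph T) -> val g = [set w; w'].
  move=> g_center.
  have [y s_y def_g] := line_vertex_mem (center_in_min_edge w_center g_center).
  have := center_in_min_edge w'_center g_center.
  by rewrite def_g !inE (negPf neq_w) /= => /eqP ->.
by case/eqP: neq_ef; apply: val_inj; rewrite !pair.
Qed.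

(** The edges at w form a clique, hence lie in a block. Conversely, a block that
contains two weight centers wy and wz is a clique, and an edge meeting both
without containing w would be yz, closing a triangle. *)
Lemma central_line w :
    is_block_graph (line_graph T) -> 2 <= #|weight_centers (line_graph T)| ->
    w \in weight_centers T ->
  central (line_graph T) = [set e : line_graph T | w \in val e].
Proof.
move=> [_ block_clique] two_centers w_center; rewrite /central.
have /negPf -> : #|weight_centers (line_graph T)| != 1 by lia.
pose star := [set e : line_graph T | w \in val e].
have sub_star : weight_centers (line_graph T) \subset star.
  by apply/subsetP => e e_center; rewrite inE center_in_min_edge.
apply/setP/subset_eqP/andP; split; apply/subsetP => g; last first.
  move=> g_star; apply/bigcupP.
  pose P (S : {set line_graph T}) := connected_in S && [forall v, ~~ cut_vertex S v].
  have star_clique : {in star &, forall e f, e != f -> sedge e f}.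
    by move=> e f; rewrite !inE => w_e w_f neq_ef; apply: line_sedge neq_ef w_e w_f.
  have P_star : P star.
    rewrite /P clique_connected_in //=; apply/forallP => e.
    rewrite /cut_vertex clique_connected_in ?andbF // => f h.
    by rewrite !inE => /andP[_ w_f] /andP[_ w_h]; apply: star_clique; rewrite inE.
  have [B B_max sub_B] := maxset_exists P_star.
  by exists B; [rewrite [block B]B_max (subset_trans sub_star) | apply: (subsetP sub_B)].
case/bigcupP=> B /andP[B_block sub_B] g_B; rewrite inE.
have [e [f [e_center f_center neq_ef]]] := card_gt1P two_centers.
have B_clique := block_clique B B_block.
have spoke h : h \in weight_centers (line_graph T) -> w \notin val g ->
    exists2 y, val h = [set w; y] /\ sedge w y & y \in val g.
  move=> h_center w_g; have w_h := center_in_min_edge w_center h_center.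
  have neq_hg : h != g by apply: contraNneq w_g => <-.
  have h_B := subsetP sub_B h h_center.
  have [_ [y y_h y_g]] := line_sedgeP (B_clique h g h_B g_B neq_hg).
  have [y' s_y def_h] := line_vertex_mem w_h.
  move: y_h; rewrite def_h !inE => /orP[]/eqP eq_y; first by rewrite -eq_y y_g in w_g.
  by exists y'; [split | rewrite -eq_y].
apply/negPn/negP => w_g.
have [y [def_e s_y] y_g] := spoke e e_center w_g.
have [z [def_f s_z] z_g] := spoke f f_center w_g.
have [y' s_yy' def_g] := line_vertex_mem y_g.
move: z_g; rewrite def_g !inE => /orP[]/eqP eq_z.
  by case/eqP: neq_ef; apply: val_inj; rewrite def_e def_f eq_z.
rewrite -eq_z in s_yy' def_g; rewrite sedge_sym in s_y.
suff eq_w : w = z by rewrite def_g eq_w set22 in w_g.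
apply: (lower_neighbor_uniq treeT (x := w) s_y s_yy'); first by rewrite distxx.
by rewrite (dist_sym cT w y) (dist_edge cT s_y) (dist_edge cT s_z).
Qed.

(** The distance of two vertices is one more than that of the first and the last
edge of the path between them, and the outer endpoints of two edges are one
farther apart than the edges. The edge e0 excludes the one-vertex tree. *)
Lemma diam_line (e0 : line_graph T) : diam T = (diam (line_graph T)).+1.
Proof.
apply/eqP; rewrite eqn_leq; apply/andP; split.
  apply: diam_le => u v; have [->|neq_uv] := eqVneq u v; first by rewrite distxx.
  have neq_vu : v != u by rewrite eq_sym.
  have [s_u _] := parentP treeT neq_uv; have [s_v _] := parentP treeT neq_vu.
  have [e def_e] := edge_line_vertex s_u; have [f def_f] := edge_line_vertex s_v.
  have [eq_ef|neq_ef] := eqVneq e f.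
    have : u \in val f by rewrite -eq_ef def_e set21.
    rewrite def_f !inE (negPf neq_uv) /= => /eqP eq_u.
    by rewrite eq_u (dist_sym cT) (dist_edge cT s_v).
  have := dist_diam e f.
  by case: (line_dist_aligned def_e def_f neq_ef) => [[]|[[]|[[]|[]]]]; lia.
have [a [b [s_ab def_e0]]] := line_vertexP e0.
have := dist_diam a b; rewrite (dist_edge cT s_ab) => diam_gt0.
rewrite -(prednK diam_gt0) ltnS; apply: diam_le => e f.
have [->|neq_ef] := eqVneq e f; first by rewrite distxx.
have [a' [b' [s_e def_e]]] := line_vertexP e.
have [c [d [s_f def_f]]] := line_vertexP f.
have := dist_diam a' c; have := dist_diam a' d.
have := dist_diam b' c; have := dist_diam b' d.
by case: (line_dist_aligned def_e def_f neq_ef) => [[]|[[]|[[]|[]]]]; lia.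
Qed.

Section Levels.

Variable w : T.
Hypothesis centralE : central (line_graph T) = [set e : line_graph T | w \in val e].

Lemma dist_spoke v y e f :
    v != w -> val e = [set v; parent w v] -> val f = [set w; y] ->
    dist w v = (dist y v).+1 ->
  (dist e f).+1 = dist w v.
Proof.
move=> neq_vw def_e def_f d_v; have [s_v d_p] := parentP treeT neq_vw.
have [eq_ef|neq_ef] := eqVneq e f.
  have : v \in val f by rewrite -eq_ef def_e set21.
  by rewrite eq_ef distxx def_f !inE (negPf neq_vw) /= d_v => /eqP ->; rewrite distxx.
move: d_v d_p; rewrite !(dist_sym cT w) (dist_sym cT y).
by case: (line_dist_aligned def_e def_f neq_ef) => [[]|[[]|[[]|[]]]]; lia.
Qed.

Lemma spoke_toward v :
  v != w ->
  exists y f, [/\ val f = [set w; y], f \in central (line_graph T)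
                & dist w v = (dist y v).+1].
Proof.
rewrite eq_sym => neq_wv; have [y s_y] := closer_neighbor cT neq_wv.
rewrite !(dist_sym cT v) => d_v; have [f def_f] := edge_line_vertex s_y.
by exists y, f; rewrite def_f centralE inE def_f set21.
Qed.

Lemma level_line v e :
  v != w -> val e = [set v; parent w v] -> (level e).+1 = dist w v.
Proof.
move=> neq_vw def_e; have [y [f [def_f f_central d_v]]] := spoke_toward neq_vw.
have d_f := dist_spoke neq_vw def_e def_f d_v.
rewrite (level_eq f_central) => [|g]; first exact: d_f.
rewrite centralE inE => w_g.
have [z s_z def_g] := line_vertex_mem w_g.
have [eq_eg|neq_eg] := eqVneq e g.
  have : v \in val g by rewrite -eq_eg def_e set21.
  rewrite def_g !inE (negPf neq_vw) /= => /eqP eq_v.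
  by move: d_f; rewrite eq_v (dist_edge cT s_z) => -[->].
move: d_f; rewrite !(dist_sym cT w).
by case: (line_dist_aligned def_e def_g neq_eg) => [[]|[[]|[[]|[]]]]; lia.
Qed.

(** Take as central vertex the edge wy with y on the way to v: it is nearest to
both e and e', and e lies between it and e'. *)
Lemma ancestor_line v v' e e' :
    v != w -> v' != w ->
    val e = [set v; parent w v] -> val e' = [set v'; parent w v'] ->
    dist w v' = dist w v + dist v v' -> dist e e' = dist v v' ->
  ancestor e e'.
Proof.
move=> neq_vw neq_v'w def_e def_e' d_v' d_e.
have [y [f [def_f f_central d_y]]] := spoke_toward neq_vw.
have d_yv' : dist w v' = (dist y v').+1.
  have := dist_triangle cT v y v'; have := dist_triangle cT y w v'.
  by rewrite (dist_edge cT (line_vertex_sedge def_f)); lia.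
have d_f := dist_spoke neq_vw def_e def_f d_y.
have d_f' := dist_spoke neq_v'w def_e' def_f d_yv'.
apply/exists_inP; exists f => //; rewrite (mem_geodesic cG) !(dist_sym cG f) d_e.
by have := level_line neq_v'w def_e'; lia.
Qed.

(** The edges at v and v' are aligned. Either the parents are the two inner
vertices, or one of v, v' is inner; then its parent is farther from the other
edge, and [dist_below] makes it an ancestor. *)
Lemma dist_line_or_ancestor v v' e e' :
    v != w -> v' != w -> v != v' ->
    val e = [set v; parent w v] -> val e' = [set v'; parent w v'] ->
  [\/ dist v v' = (dist e e').+1, ancestor e e' | ancestor e' e].
Proof.
move=> neq_vw neq_v'w neq_vv' def_e def_e'.
have [s_v d_v] := parentP treeT neq_vw; have [s_v' d_v'] := parentP treeT neq_v'w.
have neq_ee' : e != e'.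
  apply/eqP => eq_e; move: def_e'; rewrite -eq_e def_e.
  case/set2_eq=> [[eq_v]|[eq_v eq_v']]; first by rewrite eq_v eqxx in neq_vv'.
  by rewrite eq_v' in d_v; rewrite -eq_v in d_v'; lia.
have := @dist_below T treeT w v v'; have := @dist_below T treeT w v' v.
rewrite (dist_sym cT v' v) (dist_sym cT _ v).
case: (line_dist_aligned def_e def_e' neq_ee') => [[h1 h2 h3 h4]|].
  rewrite h2 h4 => /(_ erefl neq_v'w) d_w _; apply: Or33.
  by apply: ancestor_line neq_v'w neq_vw def_e' def_e _ _;
    rewrite ?(dist_sym cT v') ?(dist_sym cG e') ?h2.
case=> [[h1 h2 h3 h4]|[[h1 h2 h3 h4]|[h1 h2 h3 h4]]] dw' dw.
- exact: Or31.
- by have := dw' _ neq_v'w; have := dw _ neq_vw; rewrite -(dist_eq0 cT) in neq_vv'; lia.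
- apply: Or32; apply: (ancestor_line neq_vw neq_v'w def_e def_e') => //.
  by apply: dw neq_vw; rewrite h4 h3.
Qed.

End Levels.

End TreeLine.

(** * Lower bound for the radio number *)

Section RadioNumber.

Variable G : sgraph.
Implicit Types (f : G -> nat) (u v x : G) (s : seq G).

Lemma radio_number_le f : radio_labeling f -> radio_number G <= span f.
Proof.
move=> radio_f; rewrite /radio_number; case: ex_minnP => m _; apply.
by apply/asboolP; exists f.
Qed.

Lemma radio_number_attained :
  exists2 f : G -> nat, radio_labeling f & span f = radio_number G.
Proof.
rewrite /radio_number; case: ex_minnP => m /asboolP[f [radio_f span_f]] _.
by exists f.
Qed.

Lemma le_span f u v : f u <= f v + span f.
Proof.
suff : `|f u - f v|%N <= span f by lia.
apply: leq_trans (leq_bigmax u).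
exact: (leq_bigmax (F := fun v => `|f u - f v|%N) v).
Qed.

Lemma span_le f k : (forall v, f v <= k) -> span f <= k.
Proof.
move=> le_k; apply/bigmax_leqP => u _; apply/bigmax_leqP => v _.
by have := le_k u; have := le_k v; lia.
Qed.

(** Each step along the list raises the label by at least d(G) + 1 - L x - L y;
in the sum each level counts twice, except at the two ends. *)
Lemma radio_path f (L : G -> nat) x s :
    radio_labeling f -> (forall u v, dist u v <= L u + L v) ->
    uniq (x :: s) -> path (fun u v => f u <= f v) x s ->
  f x + size s * (diam G).+1 + L x + L (last x s)
    <= f (last x s) + 2 * \sum_(y <- x :: s) L y.
Proof.
move=> radio_f dist_L; elim: s x => [|y s IHs] x; first by rewrite big_seq1 /=; lia.
rewrite [uniq _]/= [path _ _ _]/= => /andP[x_s uniq_s] /andP[le_xy path_s].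
have := IHs y uniq_s path_s; rewrite [in X in _ -> X]big_cons /=.
have neq_xy : x != y by apply: contraNneq x_s => ->; rewrite inE eqxx.
have := radio_f x y neq_xy; have := dist_L x y.
move: (\sum_(_ <- _) _) => sum.
rewrite mulSn; lia.
Qed.

(** L stands for the levels; it may vanish only at w, so that the two ends of
the list of vertices by increasing label contribute at least 1. *)
Lemma radio_number_ge (L : G -> nat) w :
    1 < #|G| -> (forall u v, dist u v <= L u + L v) -> (forall v, v != w -> 0 < L v) ->
  #|G|.-1 * (diam G).+1 + 1 <= radio_number G + 2 * \sum_v L v.
Proof.
move=> card_G dist_L L_gt0; have [f radio_f <-] := radio_number_attained.
pose r := relpre f leq.
have total_r : total r by move=> u v; apply: leq_total.
have := sort_sorted total_r (enum G); have := sort_uniq r (enum G).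
rewrite enum_uniq.
have := size_sort r (enum G); rewrite -cardE => size_s.
have -> : \sum_v L v = \sum_(v <- sort r (enum G)) L v.
  rewrite -[LHS]big_enum; apply/esym/perm_big/permEl/perm_sort.
case: (sort r _) size_s => [|x s] /= <- in card_G *; first by [].
move=> uniq_s path_s; have := radio_path radio_f dist_L uniq_s path_s.
have : 0 < L x + L (last x s).
  have [eq_xw|/L_gt0] := eqVneq x w; last by lia.
  suff /L_gt0 : last x s != w by lia.
  case: s card_G uniq_s {path_s} => //= y s _ /andP[x_s _].
  by apply: contraNneq x_s => last_w; rewrite eq_xw -last_w mem_last.
have := le_span f (last x s) x.
move: (\sum_(_ <- _) _) => sum; lia.
Qed.

End RadioNumber.

(** * The labeling of the tree *)

Section TreeLabeling.

Variables (T : sgraph) (p : nat).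
Hypotheses (treeT : is_tree T) (orderT : #|T| = p).
Let cT := tree_connected treeT.
Local Notation G := (line_graph T).
Hypothesis cG : connected G.
Variables (w : T) (u : nat -> G) (g : G -> nat).
Hypothesis center_w : weight_centers T = [set w].
Hypothesis centralE : central G = [set e : G | w \in val e].
Hypothesis ordering_u : is_ordering (p - 1) u.

Lemma level_tree v : level v = dist w v.
Proof.
have central_T : central T = [set w] by rewrite /central center_w cards1 eqxx.
rewrite (dist_sym cT); apply: level_eq; rewrite central_T ?set11 // => x.
by rewrite inE => /eqP ->.
Qed.

(** The default value u 0 is taken only by sets that are not edges. *)
Definition edge_vertex (E : {set T}) : G := insubd (u 0) E.

Definition parent_edge v : G := edge_vertex [set v; parent w v].

Lemma parent_edgeE v : v != w -> val (parent_edge v) = [set v; parent w v].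
Proof.
move=> neq_vw; rewrite insubdK //; apply: mem_edge_set.
by have [] := parentP treeT neq_vw.
Qed.

Lemma total_level_tree : total_level T = total_level G + (p - 1).
Proof.
rewrite /total_level (bigD1 w) //= level_tree distxx add0n.
have -> : p - 1 = \sum_(e : G) 1.
  by rewrite sum1_card -orderT -(card_line treeT) subSS subn0.
rewrite -big_split /=.
have -> : \sum_(e : G) (level e + 1) = \sum_(e : G) (level (edge_vertex (val e)) + 1).
  by apply: eq_bigr => e _; rewrite /edge_vertex valKd.
rewrite (sum_line_vertices treeT w (fun E => level (edge_vertex E) + 1)).
apply: eq_bigr => v neq_vw; rewrite level_tree addn1.
by rewrite (level_line treeT cG centralE neq_vw) // parent_edgeE.
Qed.

Lemma sum_ordering (F : G -> nat) : \sum_(i < p - 1) F (u i) = \sum_(e : G) F e.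
Proof.
rewrite [RHS](reindex (fun i : 'I_(p - 1) => u i)) //=.
apply/onW_bij/inj_card_bij => [i j|].
  by move/(ordering_u.1 _ _ (ltn_ord i) (ltn_ord j))/val_inj.
by rewrite card_ord -orderT -(card_line treeT) subSS subn0.
Qed.

Hypothesis radio_g : radio_labeling g.
Hypothesis g0 : g (u 0) = 0.
Hypothesis gS : forall i, i.+1 < p - 1 ->
  g (u i.+1) + level (u i.+1) + level (u i) = g (u i) + diam G.
Hypothesis level_pair : forall i, i.+1 < p - 1 ->
  level (u i) + level (u i.+1) <= diam G.
Hypothesis level_ends : level (u 0) + level (u (p - 2)) = 0.

(** The increment of g from u i to u i.+1 is d(G) minus the two levels, which is
nonnegative; the radio condition excludes 0. *)
Lemma labeling_gap i j : i <= j -> j < p - 1 -> g (u i) + (j - i) <= g (u j).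
Proof.
move=> le_ij; rewrite -(subnK le_ij); move: (j - i) => k {j le_ij}.
rewrite addnK; elim: k => [|k IHk] lt_p; first by rewrite addn0 add0n.
have lt_p' : (k + i).+1 < p - 1 by rewrite -addSn.
have neq_u : u (k + i).+1 != u (k + i).
  apply/eqP => /(ordering_u.1 _ _ lt_p' (ltnW lt_p')); lia.
have := radio_g neq_u; have := gS lt_p'; have := level_pair lt_p'.
have := IHk (ltnW lt_p'); have := dist_diam (u (k + i).+1) (u (k + i)).
rewrite addSn; lia.
Qed.

Lemma labeling_last : 1 < p -> g (u (p - 2)) + 2 * total_level G = (p - 2) * diam G.
Proof.
move=> p_gt1; rewrite /total_level -sum_ordering.
have partial k : k < p - 1 ->
    g (u k) + 2 * \sum_(i < k.+1) level (u i) = k * diam G + level (u 0) + level (u k).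
  elim: k => [|k IHk] lt_k; first by rewrite big_ord1 /= g0; lia.
  have := IHk (ltnW lt_k); have := gS lt_k; rewrite [in X in _ -> _ -> X]big_ord_recr /=.
  by move: (\sum_(_ < _) _) => sum; rewrite mulSn; lia.
have -> : p - 1 = (p - 2).+1 by lia.
by rewrite partial; lia.
Qed.

Hypothesis descendants_far : forall i j, i < j -> j < p - 1 ->
  ancestor (u i) (u j) \/ ancestor (u j) (u i) -> diam G < j - i.

Definition tree_labeling v := if v == w then 0 else g (parent_edge v) + (diam G).+1.

Lemma labeling_descendants e f : e != f -> ancestor e f \/ ancestor f e ->
  (diam G).+1 <= `|g e - g f|%N.
Proof.
have [i lt_i <-] := ordering_u.2 e; have [j lt_j <-] := ordering_u.2 f => neq_u.
case: (ltngtP i j) neq_u => [lt_ij|lt_ji|->]; last by rewrite eqxx.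
  move=> _ /(descendants_far lt_ij lt_j).
  by have := labeling_gap (ltnW lt_ij) lt_j; lia.
move=> _ /or_comm/(descendants_far lt_ji lt_i).
by have := labeling_gap (ltnW lt_ji) lt_i; lia.
Qed.

Lemma tree_labeling_radio : radio_labeling tree_labeling.
Proof.
move=> x y neq_xy; rewrite (diam_line treeT cG (u 0)) /tree_labeling.
have dist_gt0 : 0 < dist x y by rewrite lt0n (dist_eq0 cT).
have [eq_x|neq_xw] := eqVneq x w; have [eq_y|neq_yw] := eqVneq y w.
- by rewrite eq_x eq_y eqxx in neq_xy.
- by lia.
- by lia.
have val_x := parent_edgeE neq_xw; have val_y := parent_edgeE neq_yw.
have neq_e : parent_edge x != parent_edge y.
  apply/eqP => eq_e; have := val_y; rewrite -eq_e val_x.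
  have [_] := parentP treeT neq_xw; have [_] := parentP treeT neq_yw.
  move=> d_y d_x /set2_eq[[eq_xy _]|[eq_x eq_y]]; first by rewrite eq_xy eqxx in neq_xy.
  by rewrite eq_y in d_x; rewrite -eq_x in d_y; lia.
have far := labeling_descendants neq_e; have := radio_g neq_e.
case: (dist_line_or_ancestor treeT cG centralE neq_xw neq_yw neq_xy val_x val_y).
- by lia.
- by move/or_introl/far; lia.
- by move/or_intror/far; lia.
Qed.

Lemma radio_number_tree_le : 1 < p ->
  radio_number T + 2 * total_level G <= (p - 1) * diam G + 1.
Proof.
move=> p_gt1; have := radio_number_le tree_labeling_radio.
have le_g e : g e <= g (u (p - 2)).
  have [i lt_i <-] := ordering_u.2 e.
  by have := @labeling_gap i (p - 2); lia.
have le_h v : tree_labeling v <= g (u (p - 2)) + (diam G).+1.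
  by rewrite /tree_labeling; case: eqP => // _; rewrite leq_add2r.
have := span_le le_h; have := labeling_last p_gt1.
have -> : p - 1 = (p - 2).+1 by lia.
rewrite mulSn; lia.
Qed.

End TreeLabeling.

(** * The radio number of the tree *)

Theorem theorem5p12 (T : sgraph) (p : nat)
  (treeT : is_tree T) (orderT : #|T| = p)
  (two_centers : 2 <= #|weight_centers (line_graph T)|)
  (lbG : lower_bound_block_graph (line_graph T))
  (u : nat -> line_graph T) (ordering_u : is_ordering (p - 1) u)
  (cond_a : level (u 0) + level (u (p - 2)) = eps (line_graph T))
  (cond_b : forall i, i + 3 <= p ->
     [/\ rho (u i) (u i.+1) = 0, phi (u i) (u i.+1) = 0
       & delta (u i) (u i.+1) = 1 - eps (line_graph T)])
  (cond_c : exists f : line_graph T -> nat,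
     [/\ f (u 0) = 0,
         forall i, i + 3 <= p ->
           ((f (u i.+1))%:Z = (f (u i))%:Z
              + (diam (line_graph T))%:Z + (eps (line_graph T))%:Z
              - (level (u i.+1))%:Z - (level (u i))%:Z)%R
       & radio_labeling f])
  (descendants_far : forall i j, i < j -> j + 2 <= p ->
     ancestor (u i) (u j) \/ ancestor (u j) (u i) ->
     diam (line_graph T) + 1 <= j - i) :
  lower_bound_tree T /\
  radio_number T = radio_number (line_graph T) + diam (line_graph T) + 1.
Proof.
have cT := tree_connected treeT; have [[cG block_clique] rnG] := lbG.
have [w center_w] := weight_center_uniq treeT cG two_centers.
have w_center : w \in weight_centers T by rewrite center_w set11.
have centralE := central_line treeT cG (conj cG block_clique) two_centers w_center.
have card_T := card_line treeT.
have card_G : 1 < #|line_graph T| := leq_trans two_centers (max_card _).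
have p_gt2 : 2 < p by lia.
have epsG : eps (line_graph T) = 0 by rewrite /eps; case: eqP two_centers => // ->.
have epsT : eps T = 1 by rewrite /eps center_w cards1.
have [g [g0 g_step radio_g]] := cond_c.
rewrite epsG in cond_a cond_b g_step.
have gS i : i.+1 < p - 1 ->
    g (u i.+1) + level (u i.+1) + level (u i) = g (u i) + diam (line_graph T).
  by move=> lt_i; have := g_step i; lia.
have level_pair i : i.+1 < p - 1 ->
    level (u i) + level (u i.+1) <= diam (line_graph T).
  move=> lt_i; have [_ _] : [/\ rho (u i) (u i.+1) = 0, phi (u i) (u i.+1) = 0
       & delta (u i) (u i.+1) = 1 - 0] by apply: cond_b; lia.
  (* A central vertex c on the geodesic bounds both levels by its distances to
     the ends, which add up to at most the diameter. *)
  rewrite /delta; case: ltnP => // /ltnW/card_gt0P[c]; rewrite inE (mem_geodesic cG).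
  case/andP=> /eqP d_c c_central _.
  apply: leq_trans (dist_diam (u i) (u i.+1)).
  by rewrite -d_c leq_add ?level_le // (dist_sym cG) level_le.
have far i j : i < j -> j < p - 1 ->
    ancestor (u i) (u j) \/ ancestor (u j) (u i) -> diam (line_graph T) < j - i.
  by move=> lt_ij lt_j anc; rewrite -addn1; apply: descendants_far lt_ij _ anc; lia.
have diamT := diam_line treeT cG (u 0).
have levelT := level_tree treeT center_w.
have total_T := total_level_tree treeT orderT cG u center_w centralE.
have le_rn : radio_number T + 2 * total_level (line_graph T)
             <= (p - 1) * diam (line_graph T) + 1.
  by apply: (@radio_number_tree_le T p treeT orderT cG w u g) => //; lia.
have ge_rn : #|T|.-1 * (diam T).+1 + 1 <= radio_number T + 2 * total_level T.
  apply: (@radio_number_ge T (@level T) w) => [|x y|v neq_v].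
  - by rewrite -card_T ltnW.
  - by rewrite !levelT -(dist_sym cT x) (dist_triangle cT).
  - by rewrite levelT lt0n (dist_eq0 cT) eq_sym.
have q_eq : #|line_graph T| = p - 1 by lia.
rewrite /lower_bound_tree /LB epsT diamT total_T orderT in ge_rn *.
rewrite /LB epsG q_eq in rnG.
have [q def_p] : exists q, p = q.+2 by exists (p - 2); lia.
rewrite def_p subn1 /= in rnG le_rn ge_rn *.
by split; [split=> // |]; lia.
Qed.
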